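(* For a single decision tree with $n$ nodes on $\mathbb{R}^d$, defining a classifier $f:\mathbb{R}^d\to\{1,\dots,C\}$, and an input $x\in\mathbb{R}^d$ with label $y_0=f(x)$, there exists a linear time algorithm, taking $O(n)$ time, for finding the minimum adversarial perturbation and computing exactly $$r^*=\min_{\delta}\ \|\delta\|_\infty\quad\text{s.t.}\quad f(x+\delta)\neq y_0 .$$
   Context: A decision tree on $\mathbb{R}^d$ with $n$ nodes is a rooted binary tree in which each internal node $i$ has a left child, a right child and a univariate feature-threshold pair $(t_i,\eta_i)$ with $t_i\in\{1,\dots,d\}$ and $\eta_i\in\mathbb{R}$. An input $x=[x_1,\dots,x_d]$ starts at the root and at internal node $i$ is passed to the left child if $x_{t_i}\le\eta_i$ and to the right child otherwise, until it reaches a leaf node. Each leaf $i$ has a value $v_i\in\{1,\dots,C\}$, the predicted class label, and $f(x)$ is the value of the leaf reached by $x$. Here $C$ is the number of classes, and $y_0=f(x)$ is assumed to be the correct label of $x$. The minimum adversarial perturbation is the perturbation $\delta\in\mathbb{R}^d$ of smallest $\ell_\infty$ norm that changes the predicted label, and $r^*$ is its $\ell_\infty$ norm.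
   Formalization: The minimum defining r* need not be attained (e.g. d=1, x=0, split x≤1) or feasible (f constant), so r* is taken as the infimum (+∞ if f is constant); the algorithm outputs a minimum perturbation whenever one exists, otherwise, if r* is finite, a limit of adversarial perturbations of norm r*. *)

(* Defs.v *)
(* MathComp / MathComp-Analysis *)
From HB Require Import structures.
From mathcomp Require Import all_boot all_order all_algebra.
From mathcomp Require Import all_classical all_reals all_analysis.

Set Implicit Arguments.
Unset Strict Implicit.
Unset Printing Implicit Defensive.

Import Order.TTheory GRing.Theory Num.Theory.
Import numFieldNormedType.Exports.

Local Open Scope classical_set_scope.
Local Open Scope ring_scope.

(* Features are 0, ..., d-1 and class labels are 0, ..., C-1. *)
Inductive dtree (R : Type) (d C : nat) : Type :=
| Leaf of 'I_C
| Node (t : 'I_d) (eta : R) (l r : dtree R d C).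

Arguments Leaf {R d C} _.
Arguments Node {R d C} _ _ _ _.

(* Leaves are counted: this is the n of the O(n) bound. *)
Fixpoint num_nodes (R : Type) (d C : nat) (T : dtree R d C) : nat :=
  match T with
  | Leaf _ => 1%N
  | Node _ _ l r => (num_nodes l + num_nodes r).+1
  end.

Fixpoint classify (R : realType) (d C : nat) (T : dtree R d C) (x : 'rV[R]_d)
    : 'I_C :=
  match T with
  | Leaf v => v
  | Node t eta l r => if x ord0 t <= eta then classify l x else classify r x
  end.

Definition adversarial (R : realType) (d C : nat) (T : dtree R d C)
    (x : 'rV[R]_d) (y0 : 'I_C) : set 'rV[R]_d :=
  [set delta | classify T (x + delta) <> y0].

(* The norm of 'rV[R]_d is the sup norm (mx_norm). *)
Definition min_adversarial (R : realType) (d C : nat) (T : dtree R d C)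
    (x : 'rV[R]_d) (y0 : 'I_C) (delta : 'rV[R]_d) : Prop :=
  adversarial T x y0 delta /\
  forall delta', adversarial T x y0 delta' -> `|delta| <= `|delta'|.

(* The region x_t > eta of a right child is open on one side, so the minimum
   defining r* need not be attained: r* is the infimum, with value +oo when
   there is no adversarial perturbation. *)
Definition rstar (R : realType) (d C : nat) (T : dtree R d C)
    (x : 'rV[R]_d) (y0 : 'I_C) : \bar R :=
  ereal_inf [set (`|delta|)%:E | delta in adversarial T x y0].

(* A real random access machine, presented as a structured language.  The
   memory consists of arrays of naturals and arrays of reals (a program names
   finitely many of them); scalar variables are cells of arrays.  Every
   constant, memory access, arithmetic operation, comparison, connective,
   assignment and branching test costs one step.  Real numbers only influence
   control and addresses through comparisons, and there is no multiplication
   of naturals. *)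
Inductive nexp : Type :=
| NConst (n : nat)
| NRead (a : nat) (i : nexp)
| NAdd (e1 e2 : nexp)
| NSub (e1 e2 : nexp).

Inductive rexp : Type :=
| RConst (z : int)
| RRead (a : nat) (i : nexp)
| RAdd (e1 e2 : rexp)
| RSub (e1 e2 : rexp)
| RMul (e1 e2 : rexp)
| RDiv (e1 e2 : rexp).

Inductive bexp : Type :=
| BNEq (e1 e2 : nexp)
| BNLe (e1 e2 : nexp)
| BREq (e1 e2 : rexp)
| BRLe (e1 e2 : rexp)
| BNot (b : bexp)
| BAnd (b1 b2 : bexp).

Inductive cmd : Type :=
| CSkip
| CNSet (a : nat) (i e : nexp)
| CRSet (a : nat) (i : nexp) (e : rexp)
| CSeq (c1 c2 : cmd)
| CIf (b : bexp) (c1 c2 : cmd)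
| CWhile (b : bexp) (c : cmd).

Record store (R : Type) : Type := Store {
  nmem : nat -> nat -> nat;
  rmem : nat -> nat -> R }.

Definition upd (V : Type) (m : nat -> nat -> V) (a i : nat) (v : V) :
    nat -> nat -> V :=
  fun a' i' => if (a' == a) && (i' == i) then v else m a' i'.

Fixpoint neval (R : Type) (s : store R) (e : nexp) : nat :=
  match e with
  | NConst n => n
  | NRead a i => nmem s a (neval s i)
  | NAdd e1 e2 => (neval s e1 + neval s e2)%N
  | NSub e1 e2 => (neval s e1 - neval s e2)%N
  end.

Fixpoint reval (R : realType) (s : store R) (e : rexp) : R :=
  match e with
  | RConst z => z%:~R
  | RRead a i => rmem s a (neval s i)
  | RAdd e1 e2 => reval s e1 + reval s e2
  | RSub e1 e2 => reval s e1 - reval s e2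
  | RMul e1 e2 => reval s e1 * reval s e2
  | RDiv e1 e2 => reval s e1 / reval s e2
  end.

Fixpoint beval (R : realType) (s : store R) (b : bexp) : bool :=
  match b with
  | BNEq e1 e2 => neval s e1 == neval s e2
  | BNLe e1 e2 => (neval s e1 <= neval s e2)%N
  | BREq e1 e2 => reval s e1 == reval s e2
  | BRLe e1 e2 => reval s e1 <= reval s e2
  | BNot b1 => ~~ beval s b1
  | BAnd b1 b2 => beval s b1 && beval s b2
  end.

Fixpoint ncost (e : nexp) : nat :=
  match e with
  | NConst _ => 1%N
  | NRead _ i => (ncost i).+1
  | NAdd e1 e2 | NSub e1 e2 => (ncost e1 + ncost e2).+1
  end.

Fixpoint rcost (e : rexp) : nat :=
  match e with
  | RConst _ => 1%N
  | RRead _ i => (ncost i).+1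
  | RAdd e1 e2 | RSub e1 e2 | RMul e1 e2 | RDiv e1 e2 =>
      (rcost e1 + rcost e2).+1
  end.

Fixpoint bcost (b : bexp) : nat :=
  match b with
  | BNEq e1 e2 | BNLe e1 e2 => (ncost e1 + ncost e2).+1
  | BREq e1 e2 | BRLe e1 e2 => (rcost e1 + rcost e2).+1
  | BNot b1 => (bcost b1).+1
  | BAnd b1 b2 => (bcost b1 + bcost b2).+1
  end.

(* exec c s s' k: run from s, c halts in s' after exactly k steps.  Execution is
   deterministic, so the existence of s' and k is total correctness. *)
Inductive exec (R : realType) :
    cmd -> store R -> store R -> nat -> Prop :=
| ESkip s : exec CSkip s s 1
| ENSet a i e s :
    exec (CNSet a i e) s
      (Store (upd (nmem s) a (neval s i) (neval s e)) (rmem s))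
      (ncost i + ncost e).+1
| ERSet a i e s :
    exec (CRSet a i e) s
      (Store (nmem s) (upd (rmem s) a (neval s i) (reval s e)))
      (ncost i + rcost e).+1
| ESeq c1 c2 s1 s2 s3 k1 k2 :
    exec c1 s1 s2 k1 -> exec c2 s2 s3 k2 ->
    exec (CSeq c1 c2) s1 s3 (k1 + k2)
| EIfTrue b c1 c2 s s' k :
    beval s b -> exec c1 s s' k ->
    exec (CIf b c1 c2) s s' (bcost b + k).+1
| EIfFalse b c1 c2 s s' k :
    ~~ beval s b -> exec c2 s s' k ->
    exec (CIf b c1 c2) s s' (bcost b + k).+1
| EWhileFalse b c s :
    ~~ beval s b -> exec (CWhile b c) s s (bcost b).+1
| EWhileTrue b c s1 s2 s3 k1 k2 :
    beval s1 b -> exec c s1 s2 k1 -> exec (CWhile b c) s2 s3 k2 ->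
    exec (CWhile b c) s1 s3 (bcost b + k1 + k2).+1.

(* Input arrays of naturals: 0 = node kind (0 for a leaf, 1 for an internal
   node), 1 = left child, 2 = right child, 3 = feature, 4 = leaf label,
   5 = y0 (in cell 0).  Input arrays of reals: 0 = x, 1 = thresholds. *)

(* The tree T is stored with its root at index p.  Nothing is assumed on the
   numbering of the nodes; in particular 0, ..., n-1 in any order is allowed. *)
Fixpoint stored_at (R : Type) (d C : nat) (s : store R) (p : nat)
    (T : dtree R d C) : Prop :=
  match T with
  | Leaf v => nmem s 0 p = 0%N /\ nmem s 4 p = v :> nat
  | Node t eta l r =>
      [/\ nmem s 0 p = 1%N, nmem s 3 p = t :> nat, rmem s 1 p = eta,
          stored_at s (nmem s 1 p) l & stored_at s (nmem s 2 p) r]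
  end.

(* All arrays other than the input ones are initially zero, as usual for a
   random access machine; this is what makes a bound independent of d
   meaningful, the output perturbation being sparse. *)
Definition input_store (R : realType) (d C : nat) (T : dtree R d C)
    (x : 'rV[R]_d) (y0 : 'I_C) (s : store R) : Prop :=
  [/\ stored_at s 0 T,
      forall j : 'I_d, rmem s 0 j = x ord0 j,
      nmem s 5 0 = y0 :> nat,
      forall a i, (6 <= a)%N -> nmem s a i = 0%N
    & forall a i, (2 <= a)%N -> rmem s a i = 0].

(* Output: array 6 of naturals holds in cell 0 the flag "r* is finite"; arrays
   2 and 3 of reals hold r* (in cell 0) and the perturbation. *)
Definition output_r (R : realType) (s : store R) : \bar R :=
  if nmem s 6 0 == 0%N then +oo%E else (rmem s 2 0)%:E.

Definition output_delta (R : realType) (d : nat) (s : store R) : 'rV[R]_d :=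
  \row_(j < d) rmem s 3 j.

(* The output perturbation is a minimum adversarial perturbation whenever one
   exists; if r* is finite but not attained, it is a limit of adversarial
   perturbations and has norm r*. *)
Definition correct_output (R : realType) (d C : nat) (T : dtree R d C)
    (x : 'rV[R]_d) (y0 : 'I_C) (s : store R) : Prop :=
  [/\ output_r s = rstar T x y0,
      (exists delta, min_adversarial T x y0 delta) ->
        min_adversarial T x y0 (output_delta d s)
    & adversarial T x y0 !=set0 ->
        closure (adversarial T x y0) (output_delta d s) /\
        (`|output_delta d s|)%:E = rstar T x y0].

(* Main.v *)
(* The inputs that reach a given leaf form a cell, a product of intervals
   ]l_t, h_t], and r* is the least distance from x to a nonempty cell whose leaf
   has another label.  The sup distance from x to a nonempty cell is the largest
   violation by x of a test on the path to the leaf, hence can be updated in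
   constant time at each node; it is attained unless a strict test x_t > eta
   realises it.  A depth-first search therefore finds the best leaf in linear
   time, as long as the current bounds l_t and h_t are available in constant
   time; an array indexed by the features, restored on backtracking, gives
   access to them.  A closest perturbation for the best leaf is
   delta_t = min(h_t - x_t, r) on the tested features and 0 elsewhere; it is
   written once, by following the parent links of that leaf. *)
Require Import Defs.
From mathcomp Require Import all_boot all_order all_algebra.
From mathcomp Require Import all_classical all_reals all_analysis.
From mathcomp Require Import zify lra.

Set Implicit Arguments.
Unset Strict Implicit.
Unset Printing Implicit Defensive.

Import Order.TTheory GRing.Theory Num.Theory.
Import numFieldNormedType.Exports.

Local Open Scope ring_scope.

(** * Cells of a decision tree *)

Section SupNorm.
Variables (R : realType) (d : nat).
Implicit Types (v : 'rV[R]_d).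

Lemma coord_le_norm v (t : 'I_d) : `|v ord0 t| <= `|v|.
Proof.
rewrite [leRHS]/Num.norm /= mx_normrE; apply/bigmax_geP; right.
by exists (ord0, t).
Qed.

Lemma norm_le_coord v (c : R) :
  0 <= c -> (forall t, `|v ord0 t| <= c) -> `|v| <= c.
Proof.
move=> c0 H; rewrite [leLHS]/Num.norm /= mx_normrE; apply/bigmax_leP; split=> //.
by move=> [i j] _ /=; rewrite ord1.
Qed.

End SupNorm.

Section Paths.
Variables (R : realType) (d : nat).

(* The outcome of a test x_t <= eta, [true] meaning that it fails; a path lists
   the outcomes from the root to a node, the deepest one first. *)
Definition answer : Type := 'I_d * R * bool.
Implicit Types (a : answer) (p : seq answer) (x z : 'rV[R]_d).

Definition holds z a : bool :=
  let: (t, eta, b) := a in if b then eta < z ord0 t else z ord0 t <= eta.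

Definition in_cell p z : bool := all (holds z) p.

(* For a tight path, the deepest bound is the tightest. *)
Fixpoint bound (c : bool) p (t : 'I_d) : option R :=
  if p is (u, eta, b) :: p' then
    if (u == t) && (b == c) then Some eta else bound c p' t
  else None.

Definition lower := bound true.
Definition upper := bound false.

Fixpoint tight p : Prop :=
  if p is (u, eta, b) :: p' then
    [/\ tight p', forall l, lower p' u = Some l -> l < eta
      & forall h, upper p' u = Some h -> eta < h]
  else True.

(* The distance from x to the cell, and whether it fails to be attained. *)
Fixpoint dist x p : R * bool :=
  if p is (u, eta, b) :: p' then
    let: (r, strict) := dist x p' in
    if b then
      if r <= eta - x ord0 u then (eta - x ord0 u, true) else (r, strict)
    else
      if r < x ord0 u - eta then (x ord0 u - eta, false) else (r, strict)
  else (0, false).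

(** The radii of perturbations that reach a cell form a half-line, closed or open at the distance
    according to the flag; [admits] is membership in it. *)
Definition admits (k : R * bool) (rho : R) : bool :=
  if k.2 then k.1 < rho else k.1 <= rho.

Lemma admits_le k rho : admits k rho -> k.1 <= rho.
Proof. by rewrite /admits; case: ifP => // _ /ltW. Qed.

Lemma lt_admits k rho : k.1 < rho -> admits k rho.
Proof. by rewrite /admits; case: ifP => // _ /ltW. Qed.

(** The tie rule of [dist] is made for this: on equal violations a strict test sets the flag and a
    weak one leaves it, so each test adds exactly its own inequality on the radius. *)
Lemma admits_cons x u eta b p rho :
  admits (dist x ((u, eta, b) :: p)) rho =
  admits (dist x p) rho &&
  (if b then eta - x ord0 u < rho else x ord0 u - eta <= rho).
Proof.
rewrite /admits /=; case: (dist x p) => r s.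
case: b; [case: (leP r (_ - _))|case: (ltP r (_ - _))]; case: s => /= h;
  by apply/idP/andP => [?|[? ?]]; try split; lra.
Qed.

Lemma dist_ge0 x p : 0 <= (dist x p).1.
Proof.
elim: p => [|[[u eta] b] p] //=; case: (dist x p) => r s /=.
by case: b; [case: (leP r (_ - _))|case: (ltP r (_ - _))] => //=; lra.
Qed.

(** Each test on the path forces its coordinate to move by the violation of [x], and by strictly
    more if the test is strict. *)
Lemma in_cell_admits x z p : in_cell p z -> admits (dist x p) `|z - x|.
Proof.
elim: p => [|[[u eta] b] p IH]; first by rewrite /admits /= normr_ge0.
move=> /andP[hz /IH h]; rewrite admits_cons h /=.
have := coord_le_norm (z - x) u; rewrite !mxE ler_norml => /andP[h1 h2].
by move: hz; rewrite /holds; case: b; lra.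
Qed.

Lemma in_cell_upper p z t h : in_cell p z -> upper p t = Some h -> z ord0 t <= h.
Proof.
elim: p => //= -[[u eta] b] p IH /andP[hz /IH]; rewrite /upper /=.
by case: ifP => // /andP[/eqP <- /eqP bE] _ [<-]; move: hz; rewrite bE.
Qed.

Lemma in_cell_lower p z t l : in_cell p z -> lower p t = Some l -> l < z ord0 t.
Proof.
elim: p => //= -[[u eta] b] p IH /andP[hz /IH]; rewrite /lower /=.
by case: ifP => // /andP[/eqP <- /eqP bE] _ [<-]; move: hz; rewrite bE.
Qed.

Lemma tight_lt p t l h :
  tight p -> lower p t = Some l -> upper p t = Some h -> l < h.
Proof.
elim: p => //= -[[u eta] b] p IH [/IH {}IH hl hh].
rewrite /lower /upper /=; have [ut|_] //= := eqVneq u t; subst t.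
by case: b => /=; [move=> [<-]; exact: hh | move=> hL [<-]; exact: hl].
Qed.

(** By tightness a new threshold lies strictly inside the earlier bounds on the same feature, so
    satisfying the deepest bound implies the ones it hides. *)
Lemma in_cell_bounds p z : tight p ->
  (forall t h, upper p t = Some h -> z ord0 t <= h) ->
  (forall t l, lower p t = Some l -> l < z ord0 t) -> in_cell p z.
Proof.
elim: p => //= -[[u eta] b] p IH [/IH {}IH hl hh] U L.
have hz : holds z (u, eta, b).
  move: (U u) (L u); rewrite /upper /lower /= eqxx /=; clear.
  by case: b => /= U L; [exact: L | exact: U].
rewrite hz; apply: IH => t v tv.
- move: (U t v); rewrite /upper /=.
  case: ifP => [/andP[/eqP ut /eqP bE] _|_]; last exact.
  move: hz; rewrite -ut in tv *; rewrite /holds bE => /le_trans; apply.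
  exact/ltW/hh.
- move: (L t v); rewrite /lower /=.
  case: ifP => [/andP[/eqP ut /eqP bE] _|_]; last exact.
  move: hz; rewrite -ut in tv *; rewrite /holds bE; apply: lt_trans.
  exact: hl.
Qed.

Lemma upper_dist x p t h : upper p t = Some h -> x ord0 t - h <= (dist x p).1.
Proof.
elim: p => //= -[[u eta] b] p IH; rewrite /upper /=.
case: (dist x p) IH => r s /= IH; case: ifP => [/andP[/eqP <- /eqP ->]|_].
  by move=> [<-]; case: (ltP r (_ - _)) => //=; lra.
by move=> /IH hr; case: b; [case: (leP r (_ - _))|case: (ltP r (_ - _))] => /=; lra.
Qed.

Lemma admits_lower x p rho t l :
  admits (dist x p) rho -> lower p t = Some l -> l - x ord0 t < rho.
Proof.
elim: p => // -[[u eta] b] p IH; rewrite admits_cons => /andP[/IH {}IH ha].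
rewrite /lower /=; case: ifP => [/andP[/eqP ut /eqP bE]|_]; last exact: IH.
by move=> [<-]; move: ha; rewrite bE ut.
Qed.

Definition tested p (t : 'I_d) : bool := has (fun a => a.1.1 == t) p.

Definition coord_shift x p (rho : R) (t : 'I_d) : R :=
  if upper p t is Some h then
    if h - x ord0 t <= rho then h - x ord0 t else rho
  else rho.

(* The largest perturbation of size rho, on the tested features, that respects
   the upper bounds of the cell: if it fails a lower bound, then so does every
   perturbation of size rho. *)
Definition perturb x p (rho : R) : 'rV[R]_d :=
  \row_t if tested p t then coord_shift x p rho t else 0.

Lemma bound_tested b p t v : bound b p t = Some v -> tested p t.
Proof.
elim: p => //= -[[u eta] b'] p IH.
by case: ifP => [/andP[-> _]|_ /IH ->] //; rewrite orbT.
Qed.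

Lemma in_cell_perturb x p rho : tight p -> admits (dist x p) rho ->
  in_cell p (x + perturb x p rho).
Proof.
move=> tp ha; have rho0 := le_trans (dist_ge0 x p) (admits_le ha).
apply: in_cell_bounds => // t v tv; rewrite !mxE (bound_tested tv) /coord_shift.
  by rewrite tv; case: (leP _ rho); lra.
have := admits_lower ha tv; case hE: (upper p t) => [h|]; last lra.
by have := tight_lt tp tv hE; case: (leP _ rho); lra.
Qed.

Lemma norm_perturb x p rho : (dist x p).1 <= rho -> `|perturb x p rho| <= rho.
Proof.
move=> hr; have r0 := dist_ge0 x p.
apply: norm_le_coord => [|t]; first lra.
rewrite mxE ler_norml /coord_shift; case: ifP => _; last by lra.
case hE: (upper p t) => [h|]; last by lra.
by have := upper_dist x hE; case: (leP _ rho); lra.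
Qed.

(** Each coordinate is constant or a minimum of [rho] and a constant, hence 1-Lipschitz in [rho].
    This transfers facts from radii just above the distance to the distance itself. *)
Lemma perturb_dist x p rho rho' : rho <= rho' ->
  `|perturb x p rho - perturb x p rho'| <= rho' - rho.
Proof.
move=> hr; apply: norm_le_coord => [|t]; first lra.
rewrite !mxE ler_norml /coord_shift; case: ifP => _; last by lra.
case: (upper p t) => [h|]; last by lra.
by case: (leP _ rho); case: (leP _ rho'); lra.
Qed.

End Paths.

(** * Optimality of the perturbation towards a closest adversarial cell *)

Section Optimality.
Local Open Scope classical_set_scope.
Variables (R : realType) (d C : nat) (T : dtree R d C) (x : 'rV[R]_d) (y0 : 'I_C).
Variable p : seq (answer R d).
Let r := (dist x p).1.
Let delta := perturb x p r.
Hypothesis tight_p : tight p.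
Hypothesis cell_adversarial : forall z, in_cell p z -> classify T z <> y0.
Hypothesis cell_closest :
  forall z, classify T z <> y0 -> admits (dist x p) `|z - x|.

Lemma adversarial_admits v : adversarial T x y0 v -> admits (dist x p) `|v|.
Proof. by move=> /cell_closest; rewrite addrAC subrr add0r. Qed.

Lemma adversarial_perturb rho :
  admits (dist x p) rho -> adversarial T x y0 (perturb x p rho).
Proof. by move=> ha; apply: cell_adversarial; exact: in_cell_perturb. Qed.

Lemma closure_perturb : closure (adversarial T x y0) delta.
Proof.
move=> B /nbhs_ballP[e /= e0 eB]; exists (perturb x p (r + e / 2)); split.
  by apply/adversarial_perturb/lt_admits; rewrite -/r; lra.
apply: eB; rewrite -ball_normE /ball_ /=.
have h : r <= r + e / 2 by lra.
by have := perturb_dist x p h; rewrite -/delta; lra.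
Qed.

(** For the lower bound, the perturbation of radius [r + e] is adversarial, hence of norm at least
    [r], and it is within [e] of [delta]. *)
Lemma norm_delta : `|delta| = r.
Proof.
apply/le_anti/andP; split; first exact: norm_perturb.
apply/ler_addgt0Pr => e e0.
have h : r <= r + e by lra.
have ha : admits (dist x p) (r + e) by apply: lt_admits; rewrite -/r; lra.
have := admits_le (adversarial_admits (adversarial_perturb ha)).
have := perturb_dist x p h; rewrite -/delta -/r distrC.
have := lerB_dist (perturb x p (r + e)) delta; lra.
Qed.

Lemma rstarE : rstar T x y0 = r%:E.
Proof.
apply/le_anti/andP; split; last first.
  by apply/ereal_infP => _ [v /adversarial_admits/admits_le h <-]; rewrite lee_fin.
apply/lee_addgt0Pr => e e0; rewrite -EFinD.
have ha : admits (dist x p) (r + e) by apply: lt_admits; rewrite -/r; lra.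
apply: ge_ereal_inf; exists (`|perturb x p (r + e)|)%:E.
  by exists (perturb x p (r + e)) => //; exact: adversarial_perturb.
by rewrite lee_fin; apply: norm_perturb; rewrite -/r; lra.
Qed.

Lemma min_adversarial_perturb :
  (exists v, min_adversarial T x y0 v) -> min_adversarial T x y0 delta.
Proof.
move=> [v [adv_v min_v]].
have av := adversarial_admits adv_v.
have adv_delta : adversarial T x y0 delta.
  apply: adversarial_perturb; rewrite -/r.
  have := admits_le av; rewrite -/r le_eqVlt => /orP[/eqP rE|rv].
    by move: av; rewrite -rE.
  (* If the minimum exceeded [r], the radius halfway between them would give a smaller adversarial
     perturbation. *)
  have ha : admits (dist x p) ((r + `|v|) / 2) by apply: lt_admits; rewrite -/r; lra.
  have := min_v _ (adversarial_perturb ha).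
  by have := norm_perturb (admits_le ha); lra.
split=> // v' /adversarial_admits/admits_le; rewrite norm_delta; exact.
Qed.

End Optimality.

(** * Straight-line code and loops *)

Fixpoint loop_free (c : cmd) : bool :=
  match c with
  | CSeq c1 c2 | CIf _ c1 c2 => loop_free c1 && loop_free c2
  | CWhile _ _ => false
  | _ => true
  end.

(** A bound for loop-free code. Both branches of a conditional are added, which is enough for a
    constant; the value at a loop is a placeholder. *)
Fixpoint max_cost (c : cmd) : nat :=
  match c with
  | CSkip => 1
  | CNSet _ i e => (ncost i + ncost e).+1
  | CRSet _ i e => (ncost i + rcost e).+1
  | CSeq c1 c2 => max_cost c1 + max_cost c2
  | CIf b c1 c2 => (bcost b + (max_cost c1 + max_cost c2)).+1
  | CWhile _ _ => 0
  end.

Section Execution.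
Variable R : realType.
Implicit Types (s : store R).

Fixpoint run (c : cmd) s : store R :=
  match c with
  | CNSet a i e => Store (upd (nmem s) a (neval s i) (neval s e)) (rmem s)
  | CRSet a i e => Store (nmem s) (upd (rmem s) a (neval s i) (reval s e))
  | CSeq c1 c2 => run c2 (run c1 s)
  | CIf b c1 c2 => if beval s b then run c1 s else run c2 s
  | _ => s
  end.

Lemma run_exec c s : loop_free c ->
  exists2 k, exec c s (run c s) k & (k <= max_cost c)%N.
Proof.
elim: c s => [|a i e|a i e|c1 IH1 c2 IH2|b c1 IH1 c2 IH2|b c IH] s //=.
- by move=> _; exists 1%N => //; exact: ESkip.
- by move=> _; exists (ncost i + ncost e).+1 => //; exact: ENSet.
- by move=> _; exists (ncost i + rcost e).+1 => //; exact: ERSet.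
- move=> /andP[/(IH1 s)[k1 e1 h1] /(IH2 (run c1 s))[k2 e2 h2]].
  by exists (k1 + k2)%N; [exact: ESeq e1 e2 | exact: leq_add].
- move=> /andP[/(IH1 s)[k1 e1 h1] /(IH2 s)[k2 e2 h2]].
  case: ifPn => hb.
    by exists (bcost b + k1).+1; [exact: EIfTrue | lia].
  by exists (bcost b + k2).+1; [exact: EIfFalse | lia].
Qed.

Inductive iterates (b : bexp) (c : cmd) : nat -> store R -> store R -> Prop :=
| iterates0 s : iterates b c 0 s s
| iteratesS m s s' :
    beval s b -> iterates b c m (run c s) s' -> iterates b c m.+1 s s'.

Lemma iterates1 b c s : beval s b -> iterates b c 1 s (run c s).
Proof. by move=> hb; apply: iteratesS hb _; exact: iterates0. Qed.

Lemma iterates_trans b c m1 m2 s1 s2 s3 :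
  iterates b c m1 s1 s2 -> iterates b c m2 s2 s3 ->
  iterates b c (m1 + m2) s1 s3.
Proof. by elim=> //= m s s' hb _ IH /IH; exact: iteratesS. Qed.

(** The successor of [m] pays for the last, failing evaluation of the guard. *)
Lemma while_exec b c m s s' : loop_free c ->
  iterates b c m s s' -> ~~ beval s' b ->
  exists2 k, exec (CWhile b c) s s' k
    & (k <= (bcost b + max_cost c).+1 * m.+1)%N.
Proof.
move=> lf; elim=> {m s s'} [s hb|m s s' hb _ IH /IH[k ek hk]].
  by exists (bcost b).+1; [exact: EWhileFalse | lia].
have [k1 e1 h1] := run_exec s lf.
by exists (bcost b + k1 + k).+1; [exact: EWhileTrue e1 ek | lia].
Qed.

Lemma upd_out (V : Type) (m : nat -> nat -> V) a i v a' i' :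
  a' != a -> upd m a i v a' i' = m a' i'.
Proof. by rewrite /upd => /negbTE ->. Qed.

Lemma run_seq c1 c2 s : run (CSeq c1 c2) s = run c2 (run c1 s). Proof. by []. Qed.
Lemma run_nset a i e s : run (CNSet a i e) s =
  Store (upd (nmem s) a (neval s i) (neval s e)) (rmem s). Proof. by []. Qed.
Lemma run_rset a i e s : run (CRSet a i e) s =
  Store (nmem s) (upd (rmem s) a (neval s i) (reval s e)). Proof. by []. Qed.
Lemma run_if b c1 c2 s : run (CIf b c1 c2) s =
  if beval s b then run c1 s else run c2 s. Proof. by []. Qed.

End Execution.

Arguments run : simpl never.
Local Arguments upd _ _ _ _ _ _ _ /.

(** * The program *)

Declare Scope cmd_scope.
Local Notation "c1 ;; c2" := (CSeq c1 c2) (at level 60, right associativity) : cmd_scope.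
Local Open Scope cmd_scope.

Definition nvar (a : nat) : nexp := NRead a (NConst 0).
Definition rvar (a : nat) : rexp := RRead a (NConst 0).
Definition nset (a : nat) (e : nexp) : cmd := CNSet a (NConst 0) e.
Definition rset (a : nat) (e : rexp) : cmd := CRSet a (NConst 0) e.

(* Scalars: 6 = "an adversarial leaf was found", 7 = current frame, 8 = last
   allocated frame, 9 = frame of the best leaf.  Frames are linked into a work
   list and never freed; frame i consists of cell i of the arrays
     10 next frame     11 kind (1 = visit a node, 0 = only restore array 19)
     12 feature t      13 value for cell t of array 19
     14, 15 "there is a lower (upper) bound on x_t"; reals 4, 5 these bounds
     16 "the distance to the cell is not attained"; reals 6 this distance
     17 parent frame   18 node (the only field that changes).
   Cell t of array 19 is the deepest frame on the current path that tests t.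
   Frame 0 has no bounds and frame 1 is the root.  Temporaries: 21 node,
   22 feature t, 23 cell t of array 19, 24, 25 flags of the bounds, 26, 27
   children, 28 next frame, 29 flag of the distance, 30, 31 this flag for the
   children; reals 7 threshold, 8 x_t, 9, 10 bounds, 11 distance, 12, 13
   distance for the children. *)
Definition write_frame (k next kind feat top lf hf st par : nexp)
    (lo hi r : rexp) : cmd :=
  CNSet 10 k next;; CNSet 11 k kind;; CNSet 12 k feat;; CNSet 13 k top;;
  CNSet 14 k lf;; CNSet 15 k hf;; CNSet 16 k st;; CNSet 17 k par;;
  CRSet 4 k lo;; CRSet 5 k hi;; CRSet 6 k r.

Definition frame_at (k : nat) : nexp := NAdd (nvar 8) (NConst k).

(** Expanding a node replaces its frame on the work list by three fresh ones, in this order: left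
    child, right child, and a restore frame carrying the value that array 19 had at the tested
    feature. A child frame puts its own index there. *)
Definition write_left : cmd :=
  write_frame (frame_at 1) (frame_at 2) (NConst 1) (nvar 22) (frame_at 1)
    (nvar 24) (NConst 1) (nvar 30) (nvar 7) (rvar 9) (rvar 7) (rvar 12).

Definition write_right : cmd :=
  write_frame (frame_at 2) (frame_at 3) (NConst 1) (nvar 22) (frame_at 2)
    (NConst 1) (nvar 25) (nvar 31) (nvar 7) (rvar 7) (rvar 10) (rvar 13).

Definition write_restore : cmd :=
  write_frame (frame_at 3) (nvar 28) (NConst 0) (nvar 22) (nvar 23)
    (NConst 0) (NConst 0) (NConst 0) (nvar 7) (RConst 0) (RConst 0) (RConst 0).

Definition load : cmd :=
  nset 22 (NRead 3 (nvar 21));; nset 23 (NRead 19 (nvar 22));;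
  nset 24 (NRead 14 (nvar 23));; nset 25 (NRead 15 (nvar 23));;
  nset 26 (NRead 1 (nvar 21));; nset 27 (NRead 2 (nvar 21));;
  nset 28 (NRead 10 (nvar 7));; nset 29 (NRead 16 (nvar 7));;
  rset 7 (RRead 1 (nvar 21));; rset 8 (RRead 0 (nvar 22));;
  rset 9 (RRead 4 (nvar 23));; rset 10 (RRead 5 (nvar 23));;
  rset 11 (RRead 6 (nvar 7)).

Definition distances : cmd :=
  nset 30 (nvar 29);; rset 12 (rvar 11);;
  CIf (BRLe (RSub (rvar 8) (rvar 7)) (rvar 11)) CSkip
    (nset 30 (NConst 0);; rset 12 (RSub (rvar 8) (rvar 7)));;
  nset 31 (nvar 29);; rset 13 (rvar 11);;
  CIf (BRLe (rvar 11) (RSub (rvar 7) (rvar 8)))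
    (nset 31 (NConst 1);; rset 13 (RSub (rvar 7) (rvar 8))) CSkip.

Definition expand : cmd :=
  distances;; write_left;; write_right;; write_restore;;
  CNSet 18 (frame_at 1) (nvar 26);;
  CNSet 18 (frame_at 2) (nvar 27);;
  nset 7 (frame_at 1);;
  nset 8 (frame_at 3).

Definition flag (a : nat) : bexp := BNEq (nvar a) (NConst 1).

(* A test that the cell already decides is skipped without a new frame, so
   that all cells stay nonempty. *)
Definition internal : cmd :=
  load;;
  CIf (BAnd (flag 24) (BRLe (rvar 7) (rvar 9))) (CNSet 18 (nvar 7) (nvar 27))
 (CIf (BAnd (flag 25) (BRLe (rvar 10) (rvar 7))) (CNSet 18 (nvar 7) (nvar 26))
      expand).

Definition pop : cmd := nset 7 (NRead 10 (nvar 7)).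

Definition record_leaf : cmd := nset 6 (NConst 1);; nset 9 (nvar 7).

(** Leaves are compared lexicographically: at equal distance a leaf whose distance is not attained
    never replaces the recorded one. *)
Definition leaf : cmd :=
  CIf (BNEq (NRead 4 (nvar 21)) (nvar 5)) CSkip
 (CIf (BNot (flag 6)) record_leaf
 (CIf (BAnd (BRLe (RRead 6 (nvar 7)) (RRead 6 (nvar 9)))
        (BNot (BAnd (BREq (RRead 6 (nvar 7)) (RRead 6 (nvar 9)))
                    (BNEq (NRead 16 (nvar 7)) (NConst 1)))))
      record_leaf CSkip));;
  pop.

Definition visit : cmd :=
  nset 21 (NRead 18 (nvar 7));;
  CIf (BNEq (NRead 0 (nvar 21)) (NConst 1)) internal leaf.

Definition search_body : cmd :=
  CNSet 19 (NRead 12 (nvar 7)) (NRead 13 (nvar 7));;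
  CIf (BNEq (NRead 11 (nvar 7)) (NConst 1)) visit pop.

Definition search_guard : bexp := BNot (BNEq (nvar 7) (NConst 0)).

Definition write_delta : cmd :=
  CNSet 20 (nvar 22) (NConst 1);;
  CRSet 3 (nvar 22) (rvar 2);;
  CIf (BAnd (BNEq (NRead 15 (nvar 7)) (NConst 1))
        (BRLe (RSub (RRead 5 (nvar 7)) (RRead 0 (nvar 22))) (rvar 2)))
    (CRSet 3 (nvar 22) (RSub (RRead 5 (nvar 7)) (RRead 0 (nvar 22)))) CSkip.

(* The first frame met for a feature is the deepest one, whose bounds are the
   tightest; array 20 marks the features already met. *)
Definition output_body : cmd :=
  nset 22 (NRead 12 (nvar 7));;
  CIf (BNEq (NRead 20 (nvar 22)) (NConst 0)) write_delta CSkip;;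
  nset 7 (NRead 17 (nvar 7)).

(** The walk stops at frame 1, the root, which carries no test, and does not start from 0, the
    content of variable 9 when no adversarial leaf was found. *)
Definition output_guard : bexp := BNot (BNLe (nvar 7) (NConst 1)).

(** The zero-initialised memory supplies the rest of the root frame: node 0, no successor, no
    bounds, and distance 0, attained. *)
Definition prologue : cmd :=
  CNSet 11 (NConst 1) (NConst 1);; nset 7 (NConst 1);; nset 8 (NConst 1).

Definition epilogue : cmd :=
  rset 2 (RRead 6 (nvar 9));; nset 7 (nvar 9).

Definition attack : cmd :=
  prologue;; CWhile search_guard search_body;;
  epilogue;; CWhile output_guard output_body.

(** * Frames as records, and the effect of visiting an internal node *)

Section Frames.
Variable R : realType.
Implicit Types (s : store R).

(** The node, array 18, is left out: skipping a decided test changes it, whereas the fields kept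
    here stay fixed once the frame is allocated. *)
Record frame := Frame {
  f_next : nat; f_kind : nat; f_feat : nat; f_top : nat;
  f_lf : nat; f_hf : nat; f_st : nat; f_par : nat;
  f_lo : R; f_hi : R; f_r : R }.

Definition frame_of s (i : nat) : frame :=
  Frame (nmem s 10 i) (nmem s 11 i) (nmem s 12 i) (nmem s 13 i)
    (nmem s 14 i) (nmem s 15 i) (nmem s 16 i) (nmem s 17 i)
    (rmem s 4 i) (rmem s 5 i) (rmem s 6 i).

Definition set_frame s (k : nat) (f : frame) : store R :=
  let: Frame a b c d e f g h u v w := f in
  Store
    (upd (upd (upd (upd (upd (upd (upd (upd (nmem s)
      10 k a) 11 k b) 12 k c) 13 k d) 14 k e) 15 k f) 16 k g) 17 k h)
    (upd (upd (upd (rmem s) 4 k u) 5 k v) 6 k w).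

Lemma frame_of_set s k f i :
  frame_of (set_frame s k f) i = if i == k then f else frame_of s i.
Proof.
case: f => *; rewrite /frame_of /set_frame /= /upd /=.
by case: eqP.
Qed.

Lemma nmem_set_frame s k f a i : (a < 10)%N || (17 < a)%N ->
  nmem (set_frame s k f) a i = nmem s a i.
Proof. by case: f => *; rewrite [nmem _]/= !upd_out //; lia. Qed.

Lemma rmem_set_frame s k f a i : (a < 4)%N || (6 < a)%N ->
  rmem (set_frame s k f) a i = rmem s a i.
Proof. by case: f => *; rewrite [rmem _]/= !upd_out //; lia. Qed.

Lemma load_spec s (s' := run load s) (p := nmem s 21 0%N) (t := nmem s 3 p)
    (j := nmem s 19 t) (i := nmem s 7 0%N) :
  [/\ forall a k, (a < 22)%N -> nmem s' a k = nmem s a k,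
      forall a k, (a < 7)%N -> rmem s' a k = rmem s a k,
      [/\ nmem s' 22 0%N = t, nmem s' 23 0%N = j,
          nmem s' 24 0%N = f_lf (frame_of s j) &
          nmem s' 25 0%N = f_hf (frame_of s j)],
      [/\ nmem s' 26 0%N = nmem s 1 p, nmem s' 27 0%N = nmem s 2 p,
          nmem s' 28 0%N = f_next (frame_of s i) &
          nmem s' 29 0%N = f_st (frame_of s i)] &
      [/\ rmem s' 7 0%N = rmem s 1 p, rmem s' 8 0%N = rmem s 0 t,
          rmem s' 9 0%N = f_lo (frame_of s j),
          rmem s' 10 0%N = f_hi (frame_of s j) &
          rmem s' 11 0%N = f_r (frame_of s i)]].
Proof.
rewrite {}/s' /=; split=> // a k; first by do 8!(case: eqP => [->|_] //=).
by do 5!(case: eqP => [->|_] //=).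
Qed.

Lemma distances_spec s (s' := run distances s) (eta := rmem s 7 0%N)
    (y := rmem s 8 0%N) (r := rmem s 11 0%N) (st := nmem s 29 0%N) :
  [/\ forall a k, (a < 30)%N -> nmem s' a k = nmem s a k,
      forall a k, (a < 12)%N -> rmem s' a k = rmem s a k,
      rmem s' 12 0%N = (if r < y - eta then y - eta else r) /\
      nmem s' 30 0%N = (if r < y - eta then 0%N else st) &
      rmem s' 13 0%N = (if r <= eta - y then eta - y else r) /\
      nmem s' 31 0%N = (if r <= eta - y then 1%N else st)].
Proof.
rewrite {}/s' /distances run_seq.
set s1 := run (nset 30 _) s; rewrite run_seq run_seq run_if.
set s2 := (if _ then _ else _).
have [hn hr h12 h30] : [/\ forall a k, (a < 30)%N -> nmem s2 a k = nmem s a k,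
      forall a k, (a < 12)%N -> rmem s2 a k = rmem s a k,
      rmem s2 12 0%N = (if r < y - eta then y - eta else r) &
      nmem s2 30 0%N = (if r < y - eta then 0%N else st)].
  rewrite /s2 /s1 /=; case: leP => _ /=; split=> // a k;
  by do 2?[case: eqP => [->|_] //=].
move: s2 hn hr h12 h30 => s2 hn hr h12 h30 {s1}.
rewrite !run_seq run_if /= !hr // -/r -/eta -/y.
case: (leP r (eta - y)) => _ /=; split.
- by move=> a k ha; do 3?[case: eqP => [E|_] /=; first by lia]; exact: hn.
- by move=> a k ha; do 3?[case: eqP => [E|_] /=; first by lia]; exact: hr.
- by split; [exact: h12 | exact: h30].
- by split; rewrite ?hr // ?hn.
- by move=> a k ha; do 3?[case: eqP => [E|_] /=; first by lia]; exact: hn.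
- by move=> a k ha; do 3?[case: eqP => [E|_] /=; first by lia]; exact: hr.
- by split; [exact: h12 | exact: h30].
- by split; rewrite ?hr // ?hn.
Qed.

Definition left_frame (c t i : nat) (f : frame) (eta y r : R) (st : nat) : frame :=
  Frame (c + 2) 1 t (c + 1) (f_lf f) 1 (if r < y - eta then 0%N else st) i
    (f_lo f) eta (if r < y - eta then y - eta else r).

Definition right_frame (c t i : nat) (f : frame) (eta y r : R) (st : nat) : frame :=
  Frame (c + 3) 1 t (c + 2) 1 (f_hf f) (if r <= eta - y then 1%N else st) i
    eta (f_hi f) (if r <= eta - y then eta - y else r).

Definition restore_frame (next t j i : nat) : frame :=
  Frame next 0 t j 0 0 0 i 0%:~R 0%:~R 0%:~R.

Lemma run_write_left s (c := nmem s 8 0%N) : run write_left s =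
  set_frame s (c + 1)
    (Frame (c + 2) 1 (nmem s 22 0%N) (c + 1) (nmem s 24 0%N) 1
      (nmem s 30 0%N) (nmem s 7 0%N)
      (rmem s 9 0%N) (rmem s 7 0%N) (rmem s 12 0%N)).
Proof. reflexivity. Qed.

Lemma run_write_right s (c := nmem s 8 0%N) : run write_right s =
  set_frame s (c + 2)
    (Frame (c + 3) 1 (nmem s 22 0%N) (c + 2) 1 (nmem s 25 0%N)
      (nmem s 31 0%N) (nmem s 7 0%N)
      (rmem s 7 0%N) (rmem s 10 0%N) (rmem s 13 0%N)).
Proof. reflexivity. Qed.

Lemma run_write_restore s (c := nmem s 8 0%N) : run write_restore s =
  set_frame s (c + 3)
    (restore_frame (nmem s 28 0%N) (nmem s 22 0%N) (nmem s 23 0%N)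
      (nmem s 7 0%N)).
Proof. reflexivity. Qed.

Record internal_expanded s s' (p t j i c : nat) : Prop := {
  exp_cur : nmem s' 7 0 = (c + 1)%N;
  exp_ctr : nmem s' 8 0 = (c + 3)%N;
  exp_frame : forall k, frame_of s' k =
    if k == (c + 3)%N then restore_frame (f_next (frame_of s i)) t j i
    else if k == (c + 2)%N then
      right_frame c t i (frame_of s j) (rmem s 1 p) (rmem s 0 t)
        (f_r (frame_of s i)) (f_st (frame_of s i))
    else if k == (c + 1)%N then
      left_frame c t i (frame_of s j) (rmem s 1 p) (rmem s 0 t)
        (f_r (frame_of s i)) (f_st (frame_of s i))
    else frame_of s k;
  exp_node : forall k, nmem s' 18 k =
    if k == (c + 2)%N then nmem s 2 p else if k == (c + 1)%N then nmem s 1 p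
    else nmem s 18 k;
  exp_nmem : forall a k, (a < 7)%N || (a == 9)%N || (18 < a)%N && (a < 21)%N ->
    nmem s' a k = nmem s a k;
  exp_rmem : forall a k, (a < 4)%N -> rmem s' a k = rmem s a k }.

Lemma internalP s (s' := run internal s) (p := nmem s 21 0%N)
    (t := nmem s 3 p) (j := nmem s 19 t) (i := nmem s 7 0%N)
    (c := nmem s 8 0%N) (f := frame_of s j) (eta := rmem s 1 p) :
  let skip q :=
    (forall a k, (a < 21)%N ->
      nmem s' a k = if (a == 18%N) && (k == i) then q else nmem s a k) /\
    (forall a k, (a < 7)%N -> rmem s' a k = rmem s a k) in
  if (f_lf f == 1%N) && (eta <= f_lo f) then skip (nmem s 2 p)
  else if (f_hf f == 1%N) && (f_hi f <= eta) then skip (nmem s 1 p)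
  else internal_expanded s s' p t j i c.
Proof.
rewrite {}/s' /internal run_seq /=.
have [] := load_spec s; set s1 := run load s.
rewrite -/p -/t -/j -/i -/f => hn hr [h22 h23 h24 h25] [h26 h27 h28 h29].
move=> [g7 g8 g9 g10 g11].
move: s1 hn hr h22 h23 h24 h25 h26 h27 h28 h29 g7 g8 g9 g10 g11.
move=> s1 hn hr h22 h23 h24 h25 h26 h27 h28 h29 g7 g8 g9 g10 g11.
rewrite !run_if /= h24 h25 g7 g9 g10 -/eta.
have frE k : frame_of s1 k = frame_of s k by rewrite /frame_of !hn ?hr.
case: ((f_lf f == 1%N) && (eta <= f_lo f));
  last case: ((f_hf f == 1%N) && (f_hi f <= eta)).
- split=> a k ha; rewrite run_nset /=; last exact: hr.
  by rewrite h27 !hn //; lia.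
- split=> a k ha; rewrite run_nset /=; last exact: hr.
  by rewrite h26 !hn //; lia.
rewrite /expand run_seq.
have [] := distances_spec s1; set s2 := run distances s1.
move: s2 => s2 en er [e12 e30] [e13 e31].
have frE2 k : frame_of s2 k = frame_of s k by rewrite -frE /frame_of !en ?er.
have i7 : nmem s2 7 0%N = i by rewrite en // hn.
have i8 : nmem s2 8 0%N = c by rewrite en // hn.
rewrite -(en 22%N) // in h22; rewrite -(en 23%N) // in h23.
rewrite -(en 24%N) // in h24; rewrite -(en 25%N) // in h25.
rewrite -(en 26%N) // in h26; rewrite -(en 27%N) // in h27.
rewrite -(en 28%N) // in h28.
rewrite -(er 7%N) // in g7; rewrite -(er 9%N) // in g9.
rewrite -(er 10%N) // in g10.
rewrite run_seq run_write_left run_seq run_write_right.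
rewrite !nmem_set_frame // !rmem_set_frame // run_seq run_write_restore.
rewrite !nmem_set_frame //.
rewrite i7 i8 h22 h23 h24 h25 h28 g7 g9 g10 e12 e30 e13 e31.
rewrite (er 7%N) // in g7.
rewrite h29 g7 g8 g11; set s4 := set_frame _ _ _.
have F4 k : frame_of s4 k =
    if k == (c + 3)%N then restore_frame (f_next (frame_of s i)) t j i
    else if k == (c + 2)%N then
      right_frame c t i f eta (rmem s 0 t) (f_r (frame_of s i)) (f_st (frame_of s i))
    else if k == (c + 1)%N then
      left_frame c t i f eta (rmem s 0 t) (f_r (frame_of s i)) (f_st (frame_of s i))
    else frame_of s k.
  by rewrite /s4 !frame_of_set frE2.
have N4 a k : (a < 10)%N || (17 < a)%N -> nmem s4 a k = nmem s2 a k.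
  by move=> ha; rewrite !nmem_set_frame.
have R4 a k : (a < 4)%N || (6 < a)%N -> rmem s4 a k = rmem s2 a k.
  by move=> ha; rewrite !rmem_set_frame.
move: s4 F4 N4 R4 => s4 F4 N4 R4.
rewrite run_seq run_nset run_seq run_nset run_seq !run_nset /=.
rewrite !N4 // i8 h26 h27.
split.
- by [].
- by [].
- exact: F4.
- by move=> k; rewrite /= N4 // en // hn.
- move=> a k ha; rewrite [nmem _]/= !upd_out ?N4 ?en ?hn //; lia.
- by move=> a k ha; rewrite [rmem _]/= R4 ?er ?hr //; lia.
Qed.

End Frames.

(** * The depth-first search *)

Section Search.
Variables (R : realType) (d C : nat) (T0 : dtree R d C).
Variables (x : 'rV[R]_d) (y0 : 'I_C).
Implicit Types (s : store R) (p : seq (answer R d)) (T : dtree R d C).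

Definition enter s : store R :=
  let i := nmem s 7 0 in
  Store (upd (upd (nmem s) 19 (f_feat (frame_of s i)) (f_top (frame_of s i)))
    21 0%N (nmem s 18 i)) (rmem s).

(** Array 19 as it will be after the assignment that opens the loop body. The invariant is stated
    with it because the cell of the current frame's feature may be out of date until then. *)
Definition top_after s (u : nat) : nat :=
  let f := frame_of s (nmem s 7 0) in
  if u == f_feat f then f_top f else nmem s 19 u.

Lemma run_search_body s (i := nmem s 7 0%N) :
  run search_body s =
  if f_kind (frame_of s i) == 1%N then
    if nmem s 0 (nmem s 18 i) == 1%N then run internal (enter s)
    else run leaf (enter s)
  else Store (upd (upd (nmem s) 19 (f_feat (frame_of s i)) (f_top (frame_of s i)))
         7 0%N (f_next (frame_of s i))) (rmem s).
Proof. reflexivity. Qed.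

Lemma leafP s (s' := run leaf s) (i := nmem s 7 0%N) (f := frame_of s i)
    (g := frame_of s (nmem s 9 0%N))
    (better := (nmem s 4 (nmem s 21 0%N) != nmem s 5 0%N) &&
       ((nmem s 6 0%N != 1%N) ||
        (f_r f <= f_r g) && ~~ ((f_r f == f_r g) && (f_st f == 1%N)))) :
  [/\ nmem s' 7 0 = f_next f,
      nmem s' 6 0 = (if better then 1%N else nmem s 6 0),
      nmem s' 9 0 = (if better then i else nmem s 9 0),
      forall a k, a \notin [:: 6; 7; 9] -> nmem s' a k = nmem s a k
    & rmem s' = rmem s].
Proof.
rewrite {}/s' /leaf run_seq; set s1 := run (CIf _ _ _) s.
have -> : s1 = if better then run record_leaf s else s.
  rewrite /s1 run_if /= /better; case: (_ == _) => //=.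
  by rewrite !run_if /=; case: (_ == _) => //=; case: ifP.
case: better; rewrite /record_leaf !(run_seq, run_nset) /=; split=> // a k;
  rewrite !inE !negb_or => /and3P[/negbTE h1 /negbTE h2 /negbTE h3];
  by rewrite ?h1 ?h2 ?h3.
Qed.

(** Allocated frames survive, so the parent chain of the best leaf can still be read after the
    search. *)
Record preserved s s' : Prop := {
  pres_ctr : (nmem s 8 0 <= nmem s' 8 0)%N;
  pres_frame : forall k, (k <= nmem s 8 0)%N -> frame_of s' k = frame_of s k;
  pres_nmem : forall a k, (a < 6)%N || (a == 20%N) -> nmem s' a k = nmem s a k;
  pres_rmem : forall a k, (a < 4)%N -> rmem s' a k = rmem s a k }.

Lemma preserved_trans s1 s2 s3 :
  preserved s1 s2 -> preserved s2 s3 -> preserved s1 s3.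
Proof.
move=> [c1 f1 n1 r1] [c2 f2 n2 r2]; split.
- exact: leq_trans c1 c2.
- by move=> k hk; rewrite f2 ?f1 //; exact: leq_trans hk c1.
- by move=> a k ha; rewrite n2 ?n1.
- by move=> a k ha; rewrite r2 ?r1.
Qed.

Lemma preserved_stored s s' q T :
  preserved s s' -> stored_at s q T -> stored_at s' q T.
Proof.
move=> [_ _ n r]; elim: T q => [v|t eta l IHl rr IHr] q /=.
  by move=> [h1 h2]; rewrite !n.
by move=> [h1 h2 h3 /IHl h4 /IHr h5]; split; rewrite ?n ?r.
Qed.

Definition fkey (f : frame R) : R * bool := (f_r f, f_st f == 1%N).

Definition fbound (b : bool) (f : frame R) : option R :=
  if b then if f_lf f == 1%N then Some (f_lo f) else None
  else if f_hf f == 1%N then Some (f_hi f) else None.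

(** The parent chain of frame [i] spells the path [p]. Each frame holds both bounds of its whole
    path on its own feature, and parents have smaller indices, so bounding [i] by the allocation
    counter protects the entire chain. *)
Fixpoint represents s (i : nat) p : Prop :=
  fkey (frame_of s i) = dist x p /\
  if p is (u, eta, b) :: p' then
    [/\ (1 < i)%N, (f_par (frame_of s i) < i)%N, f_feat (frame_of s i) = u,
        forall c, fbound c (frame_of s i) = bound c p u
      & represents s (f_par (frame_of s i)) p']
  else i = 1%N.

Lemma represents_cons s i u eta b p :
  represents s i ((u, eta, b) :: p) =
  (fkey (frame_of s i) = dist x ((u, eta, b) :: p) /\
   [/\ (1 < i)%N, (f_par (frame_of s i) < i)%N, f_feat (frame_of s i) = u,
       forall c, fbound c (frame_of s i) = bound c ((u, eta, b) :: p) u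
     & represents s (f_par (frame_of s i)) p]).
Proof. by []. Qed.

Lemma represents_dist s i p :
  represents s i p -> fkey (frame_of s i) = dist x p.
Proof. by case: p => [|[[u eta] b] p] []. Qed.

Lemma preserved_represents s s' i p : preserved s s' -> (i <= nmem s 8 0)%N ->
  represents s i p -> represents s' i p.
Proof.
move=> pr; elim: p i => [|[[u eta] b] p IH] i hi.
  by rewrite /represents (pres_frame pr).
rewrite !represents_cons (pres_frame pr) // => -[h1 [h2 h3 h4 h5 h6]].
split=> //; split=> //; apply: IH h6; apply: leq_trans hi; exact: ltnW.
Qed.

(** The bound on the length of the path is what makes the output loop linear. *)
Definition best_adversarial s : Prop :=
  nmem s 6 0 = 0%N /\ nmem s 9 0 = 0%N \/
  nmem s 6 0 = 1%N /\ exists p,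
    [/\ (nmem s 9 0 <= nmem s 8 0)%N, represents s (nmem s 9 0) p, tight p,
        forall z, in_cell p z -> classify T0 z <> y0
      & (size p <= num_nodes T0)%N].

(* z is no better than the best leaf found. *)
Definition covered s (z : 'rV[R]_d) : Prop :=
  nmem s 6 0 = 1%N /\ admits (fkey (frame_of s (nmem s 9 0))) `|z - x|.

Lemma preserved_best s s' : preserved s s' ->
  nmem s' 6 0 = nmem s 6 0 -> nmem s' 9 0 = nmem s 9 0 ->
  best_adversarial s -> best_adversarial s'.
Proof.
rewrite /best_adversarial => pr -> ->; case=> [|[-> [p [h1 h2 h3 h4 h5]]]].
  by left.
right; split=> //; exists p; split=> //.
  exact: leq_trans (pres_ctr pr).
exact: preserved_represents h2.
Qed.

Lemma preserved_covered s s' z : preserved s s' ->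
  nmem s' 6 0 = nmem s 6 0 -> nmem s' 9 0 = nmem s 9 0 ->
  best_adversarial s -> covered s z -> covered s' z.
Proof.
rewrite /covered => pr -> -> h [e h2]; split=> //.
by case: h => [[]|[_ [p [h _ _ _ _]]]]; [rewrite e | rewrite (pres_frame pr)].
Qed.

Record searching s T p : Prop := {
  sr_x : forall t : 'I_d, rmem s 0 t = x ord0 t;
  sr_y0 : nmem s 5 0 = y0;
  sr_cur : (0 < nmem s 7 0 <= nmem s 8 0)%N;
  sr_kind : f_kind (frame_of s (nmem s 7 0)) = 1%N;
  sr_stored : stored_at s (nmem s 18 (nmem s 7 0)) T;
  sr_repr : represents s (nmem s 7 0) p;
  sr_top : forall t : 'I_d, (top_after s t <= nmem s 8 0)%N /\
    forall b, fbound b (frame_of s (top_after s t)) = bound b p t;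
  sr_tight : tight p;
  sr_cell : forall z, in_cell p z -> classify T0 z = classify T z;
  sr_size : (size p + num_nodes T <= num_nodes T0)%N;
  sr_best : best_adversarial s }.

(** The cell of array 19 at the frame's own feature is exempt: after a child frame, the next frame
    on the work list has the same feature and rewrites it. *)
Record searched s T p s' : Prop := {
  sd_pres : preserved s s';
  sd_cur : nmem s' 7 0 = f_next (frame_of s (nmem s 7 0));
  sd_node : forall k, (k <= nmem s 8 0)%N -> k != nmem s 7 0%N ->
    nmem s' 18 k = nmem s 18 k;
  sd_top : forall u, u != f_feat (frame_of s (nmem s 7 0)) ->
    nmem s' 19 u = nmem s 19 u;
  sd_best : best_adversarial s';
  sd_mono : forall z, covered s z -> covered s' z;
  sd_cover : forall z, in_cell p z -> classify T z <> y0 -> covered s' z }.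

Lemma guard_searching s T p : searching s T p -> beval s search_guard.
Proof. by move=> /sr_cur /andP[h _] /=; rewrite -lt0n. Qed.

Lemma enter_frame s k : frame_of (enter s) k = frame_of s k.
Proof. by []. Qed.

Lemma enter_top s u : nmem (enter s) 19 u = top_after s u.
Proof. by []. Qed.

Lemma enter_nmem s a k : (a < 19)%N || (a == 20%N) ->
  nmem (enter s) a k = nmem s a k.
Proof. by move=> h; rewrite [nmem _]/= !upd_out //; lia. Qed.

Lemma better_admits (r r' : R) (b b' : bool) rho :
  (r <= r') && ~~ ((r == r') && b) ->
  admits (r', b') rho -> admits (r, b) rho.
Proof.
by move=> /andP[]; rewrite /admits /=; case: eqVneq => [->|ne] le;
  case: b; case: b' => //= _; move: le; rewrite ?le_eqVlt ?(negbTE ne) /=; lra.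
Qed.

Lemma not_better_admits (r r' : R) (b b' : bool) rho :
  ~~ ((r <= r') && ~~ ((r == r') && b)) ->
  admits (r, b) rho -> admits (r', b') rho.
Proof.
rewrite negb_and negbK /admits /= -ltNge => /orP[|/andP[/eqP -> ->]];
  by case: b; case: b' => //=; lra.
Qed.

Lemma search_leaf s v p : searching s (Leaf v) p ->
  searched s (Leaf v) p (run search_body s).
Proof.
move=> [hx hy hc hk hs hp ht tp hcell hsz hb].
case: hs => hs0 hs4; rewrite run_search_body hk eqxx hs0 /=.
set s1 := enter s; have [] := leafP s1; set s' := run leaf s1.
have -> : nmem s1 21 0%N = nmem s 18 (nmem s 7 0%N) by [].
rewrite !enter_frame !(enter_nmem s _) //.
rewrite hs4 hy.
set i := nmem s 7 0%N; set f := frame_of s i; set g := frame_of s (nmem s 9 0%N).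
set better := _ && _; move=> h7 h6 h9 hn hr.
have pr : preserved s s'.
  split.
  - by rewrite hn.
  - by move=> k _; rewrite -(enter_frame s) /frame_of hr !hn.
  - by move=> a k ha; rewrite hn ?enter_nmem // ?inE; lia.
  - by move=> a k ha; rewrite hr.
have fE k : frame_of s' k = frame_of s k.
  by rewrite -(enter_frame s) /frame_of hr !hn.
split=> //.
- by move=> k hk1 hk2; rewrite hn.
- by move=> u hu; rewrite hn // enter_top /top_after (negbTE hu).
- case hbe: better h6 h9 => h6 h9; last exact: preserved_best hb.
  right; split; first by rewrite h6.
  exists p; rewrite h9; case/andP: hc => _ hc; split=> //.
  + exact: leq_trans (pres_ctr pr).
  + exact: preserved_represents hp.
  + move=> z /hcell -> /= vy; move: hbe; rewrite /better vy eqxx //.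
  + lia.
- move=> z [e6 hz]; rewrite /covered h6 h9 e6 fE.
  case hbe: better; last by [].
  split=> //; move: hbe; rewrite /better e6 eqxx /= => /andP[_ hbe].
  exact: better_admits hbe hz.
- move=> z hz /= vy; rewrite /covered h6 h9 fE.
  have := in_cell_admits x hz; rewrite -(represents_dist hp) => ad.
  case hbe: better; first by [].
  move: hbe; rewrite /better; have -> /= : (v != y0 :> nat).
    by apply/eqP => /val_inj.
  move=> /negbT; rewrite negb_or negbK => /andP[/eqP -> nb]; split=> //.
  exact: not_better_admits nb ad.
Qed.

(** When the cell decides the test, the frame and path are kept and only the node moves to a child,
    so searching the child subtree suffices. *)
Lemma search_skip s s' T T' p q : searching s T p ->
  (forall a k, (a < 21)%N -> nmem s' a k =
    if (a == 18%N) && (k == nmem s 7 0%N) then q else nmem (enter s) a k) ->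
  (forall a k, (a < 7)%N -> rmem s' a k = rmem s a k) ->
  stored_at s q T' ->
  (forall z, in_cell p z -> classify T z = classify T' z) ->
  (num_nodes T' < num_nodes T)%N ->
  searching s' T' p /\
  (forall s'', searched s' T' p s'' -> searched s T p s'').
Proof.
move=> [hx hy hc hk hs hp ht tp hcell hsz hb] hn hr hq hT hlt.
have n_eq a k : a \notin [:: 18; 19]%N -> (a < 21)%N -> nmem s' a k = nmem s a k.
  rewrite !inE negb_or => /andP[/negbTE h1 /negbTE h2] ha; rewrite hn // h1 /=.
  by rewrite h2 /=; case: eqP => // e; move: ha; rewrite e.
have e7 : nmem s' 7 0%N = nmem s 7 0%N by rewrite n_eq.
have fE k : frame_of s' k = frame_of s k by rewrite /frame_of !n_eq // !hr.
have tE u : nmem s' 19 u = top_after s u by rewrite hn // enter_top.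
have taE u : top_after s' u = top_after s u.
  by rewrite {1}/top_after tE e7 fE; case: ifP => // h; rewrite /top_after h.
have pr : preserved s s'.
  split=> //.
  - by rewrite n_eq.
  - by move=> a k ha; rewrite n_eq //= ?inE; lia.
  - by move=> a k ha; rewrite hr //; lia.
have e6 : nmem s' 6 0%N = nmem s 6 0%N by rewrite n_eq.
have e9 : nmem s' 9 0%N = nmem s 9 0%N by rewrite n_eq.
have e8 : nmem s' 8 0%N = nmem s 8 0%N by rewrite n_eq.
split.
  split=> //.
  - by move=> t; rewrite hr.
  - by rewrite n_eq.
  - by rewrite e7 e8.
  - by rewrite e7 fE.
  - by rewrite e7 hn // !eqxx /=; exact: preserved_stored hq.
  - rewrite e7; apply: preserved_represents hp => //; by case/andP: hc.
  - by move=> t; rewrite taE e8 fE; exact: ht.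
  - by move=> z hz; rewrite hcell // hT.
  - lia.
  - exact: preserved_best hb.
move=> s'' [dpr dcur dnode dtop dbest dmono dcover]; split=> //.
- exact: preserved_trans dpr.
- by rewrite dcur e7 fE.
- move=> k hk1 hk2; rewrite dnode ?e8 ?e7 // hn // (negbTE hk2) andbF.
  by rewrite enter_nmem.
- move=> u hu; rewrite dtop ?e7 ?fE // tE /top_after (negbTE hu) //.
- by move=> z hz; apply: dmono; exact: preserved_covered hz.
- by move=> z hz; rewrite hT //; exact: dcover.
Qed.

Lemma fkey_left c t i f (g : frame R) eta u p : fkey f = dist x p ->
  fkey (left_frame c t i g eta (x ord0 u) (f_r f) (f_st f)) =
  dist x ((u, eta, false) :: p).
Proof. by rewrite /fkey /= => <-; case: ifP. Qed.

Lemma fkey_right c t i f (g : frame R) eta u p : fkey f = dist x p ->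
  fkey (right_frame c t i g eta (x ord0 u) (f_r f) (f_st f)) =
  dist x ((u, eta, true) :: p).
Proof. by rewrite /fkey /= => <-; case: ifP. Qed.

Lemma fbound_left c t i g eta y r st u p :
  (forall b, fbound b g = bound b p u) -> forall b,
  fbound b (left_frame c t i g eta y r st) = bound b ((u, eta, false) :: p) u.
Proof. by move=> h b; rewrite /= eqxx; case: b => //=; exact: (h true). Qed.

Lemma fbound_right c t i g eta y r st u p :
  (forall b, fbound b g = bound b p u) -> forall b,
  fbound b (right_frame c t i g eta y r st) = bound b ((u, eta, true) :: p) u.
Proof. by move=> h b; rewrite /= eqxx; case: b => //=; exact: (h false). Qed.

(** By induction on the tree. A leaf or a skipped node takes one pass and an expanded node two, one
    to expand and one to restore; hence the factor 2. *)
Lemma search_tree T p s : searching s T p ->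
  exists m s', [/\ (m <= 2 * num_nodes T)%N,
    iterates search_guard search_body m s s' & searched s T p s'].
Proof.
elim: T p s => [v|u eta l IHl r IHr] p s S.
  exists 1%N, (run search_body s); split=> //; last exact: search_leaf.
  exact/iterates1/guard_searching/S.
have guard := guard_searching S; have step := iterates1 search_body guard.
have [hx hy hc hk hs hp ht tp hcell hsz hb] := S.
have [hs0 hs3 heta hl hr] := hs.
move: step; rewrite run_search_body hk eqxx hs0 eqxx.
set s2 := run internal (enter s) => step.
have := internalP (enter s); lazy beta zeta; rewrite -/s2.
set i := nmem (enter s) 7 0%N; set q := nmem (enter s) 21 0%N.
set t := nmem (enter s) 3 q; set j := nmem (enter s) 19 t.
set f := frame_of (enter s) j.
have iE : i = nmem s 7 0%N by [].
have tE : t = u by rewrite /t enter_nmem.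
have fE : forall b, fbound b f = bound b p u.
  by rewrite /f /j enter_top tE; case: (ht u).
have etaE : rmem (enter s) 1 q = eta by [].
rewrite etaE !(enter_nmem s) //.
case: ifPn => [/andP[lf1 lo1]|nlo].
  move=> [hn hrm].
  have lowE : lower p u = Some (f_lo f).
    by have := fE true; rewrite /fbound lf1 /lower => <-.
  have hsat z : in_cell p z -> classify (Node u eta l r) z = classify r z.
    move=> hz /=; have := in_cell_lower hz lowE => h; rewrite leNgt.
    by rewrite (le_lt_trans lo1 h).
  have hlt : (num_nodes r < num_nodes (Node u eta l r))%N by move=> /=; lia.
  have [S2 D2] := search_skip S hn hrm hr hsat hlt.
  have [m [s' [hm it D]]] := IHr _ _ S2.
  exists (1 + m)%N, s'; split; [move=> /=; lia | exact: iterates_trans it |].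
  exact: D2.
case: ifPn => [/andP[hf1 hi1]|nhi].
  move=> [hn hrm].
  have uppE : upper p u = Some (f_hi f).
    by have := fE false; rewrite /fbound hf1 /upper => <-.
  have hsat z : in_cell p z -> classify (Node u eta l r) z = classify l z.
    move=> hz /=; have := in_cell_upper hz uppE => h.
    by rewrite (le_trans h hi1).
  have hlt : (num_nodes l < num_nodes (Node u eta l r))%N by move=> /=; lia.
  have [S2 D2] := search_skip S hn hrm hl hsat hlt.
  have [m [s' [hm it D]]] := IHl _ _ S2.
  exists (1 + m)%N, s'; split; [move=> /=; lia | exact: iterates_trans it |].
  exact: D2.
set c := nmem s 8 0%N => X.
have x_u : rmem (enter s) 0 t = x ord0 u by rewrite tE -hx.
have jE : j = top_after s u by rewrite /j enter_top tE.
have [jc _] := ht u; rewrite -jE -/c in jc.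
case/andP: hc => i0 ic; rewrite -iE -/c in i0 ic.
(* The failure of both skipping tests is exactly the tightness of the two extended paths. *)
have lo_lt v : lower p u = Some v -> v < eta.
  move=> hv; move: nlo; have := fE true; rewrite -/(lower p u) hv /fbound.
  by case: ifP => //= _ [->]; rewrite -ltNge.
have hi_gt v : upper p u = Some v -> eta < v.
  move=> hv; move: nhi; have := fE false; rewrite -/(upper p u) hv /fbound.
  by case: ifP => //= _ [->]; rewrite -ltNge.
have tpL : tight ((u, eta, false) :: p) by split.
have tpR : tight ((u, eta, true) :: p) by split.
have X7 := exp_cur X; have X8 := exp_ctr X; have XF := exp_frame X.
rewrite !enter_frame x_u tE etaE in XF.
have X18 := exp_node X.
have P2 : preserved s s2.
  split.
  - by rewrite X8; lia.
  - by move=> k hk2; rewrite XF; do 3?[case: eqP => [?|_]; first lia].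
  - move=> a k ha; rewrite (exp_nmem X) ?enter_nmem //; lia.
  - by move=> a k ha; rewrite (exp_rmem X).
have B2 : best_adversarial s2.
  by apply: preserved_best hb => //; rewrite (exp_nmem X).
have X19 v : nmem s2 19 v = top_after s v by rewrite (exp_nmem X) // enter_top.
have F1 : frame_of s2 (c + 1) = left_frame c u i f eta (x ord0 u)
    (f_r (frame_of s i)) (f_st (frame_of s i)).
  by rewrite XF !eqn_add2l.
have SL : searching s2 l ((u, eta, false) :: p).
  split.
  - by move=> v; rewrite (pres_rmem P2).
  - by rewrite (pres_nmem P2).
  - by rewrite X7 X8; lia.
  - by rewrite X7 F1.
  - rewrite X7 X18 eqn_add2l /= eqxx; exact: preserved_stored P2 hl.
  - rewrite X7 represents_cons F1; split.
      exact/fkey_left/represents_dist.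
    split=> //; [lia | move=> /=; lia | exact: fbound_left |].
    exact: preserved_represents hp.
  - move=> v; rewrite X8 /top_after X7 F1 /= X19.
    case: ifPn => [/eqP/val_inj ->|uv].
      by split; [lia | rewrite F1 => b; exact: fbound_left].
    have [h1 h2] := ht v; split; first by lia.
    by move=> b /=; rewrite (pres_frame P2) // h2 -val_eqE eq_sym (negbTE uv).
  - exact: tpL.
  - move=> z /= /andP[zu hz]; rewrite hcell //=; move: zu.
    by rewrite /holds => ->.
  - by move: hsz => /=; lia.
  - exact: B2.
have [m1 [s3 [hm1 it1 D3]]] := IHl _ _ SL.
have C3 := pres_ctr (sd_pres D3); rewrite X8 in C3.
have P3 := preserved_trans P2 (sd_pres D3).
have F2 : frame_of s3 (c + 2) = right_frame c u i f eta (x ord0 u)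
    (f_r (frame_of s i)) (f_st (frame_of s i)).
  by rewrite (pres_frame (sd_pres D3)) ?X8 ?XF ?eqn_add2l //; lia.
have X7' : nmem s3 7 0%N = (c + 2)%N by rewrite (sd_cur D3) X7 F1.
have X18' k : (k <= c + 3)%N -> k != (c + 1)%N -> nmem s3 18 k = nmem s2 18 k.
  by move=> hk1 hk2; rewrite (sd_node D3) ?X8 ?X7.
have X19' v : v != u :> nat -> nmem s3 19 v = top_after s v.
  by move=> hv; rewrite (sd_top D3) ?X7 ?F1 // X19.
have SR : searching s3 r ((u, eta, true) :: p).
  split.
  - by move=> v; rewrite (pres_rmem P3).
  - by rewrite (pres_nmem P3).
  - by rewrite X7'; lia.
  - by rewrite X7' F2.
  - rewrite X7' X18' ?eqn_add2l //; last lia.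
    by rewrite X18 eqxx; exact: preserved_stored P3 hr.
  - rewrite X7' represents_cons F2; split.
      exact/fkey_right/represents_dist.
    split=> //; [lia | move=> /=; lia | exact: fbound_right |].
    exact: preserved_represents hp.
  - move=> v; rewrite /top_after X7' F2 /=.
    case: ifPn => [/eqP/val_inj ->|uv].
      by split; [lia | rewrite F2 => b; exact: fbound_right].
    have [h1 h2] := ht v; rewrite X19' //; split; first by lia.
    by move=> b /=; rewrite (pres_frame P3) // h2 -val_eqE eq_sym (negbTE uv).
  - exact: tpR.
  - move=> z /= /andP[zu hz]; rewrite hcell //=; move: zu.
    by rewrite /holds ltNge => /negbTE ->.
  - by move: hsz => /=; lia.
  - exact: sd_best D3.
have [m2 [s4 [hm2 it2 D4]]] := IHr _ _ SR.
have P4 := preserved_trans P3 (sd_pres D4).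
have C4 := pres_ctr (sd_pres D4).
have F3 : frame_of s4 (c + 3) = restore_frame R (f_next (frame_of s i)) u j i.
  rewrite (pres_frame (sd_pres D4)) // (pres_frame (sd_pres D3)) ?X8 //.
  by rewrite XF eqxx.
have X7'' : nmem s4 7 0%N = (c + 3)%N by rewrite (sd_cur D4) X7' F2.
(* A last pass, on the restore frame, puts [j] back in cell [u] of array 19 and moves on to the
   successor of the original frame. *)
have guard4 : beval s4 search_guard by rewrite /= X7''; lia.
have it3 := iterates1 search_body guard4.
move: it3; rewrite run_search_body X7'' F3 /=.
set s5 := Store _ _ => it3.
have P45 : preserved s4 s5.
  split=> //.
  - by move=> a k ha; rewrite [nmem _]/= !upd_out //; lia.
have P5 := preserved_trans P4 P45.
exists (1 + (m1 + (m2 + 1)))%N, s5; split.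
- by move=> /=; lia.
- exact: iterates_trans step (iterates_trans it1 (iterates_trans it2 it3)).
split.
- exact: P5.
- by [].
- move=> k hk1 hk2; rewrite [nmem s5]/= !upd_out //.
  rewrite (sd_node D4) ?X7'; try lia.
  rewrite X18' ?X18; try lia.
  by rewrite !ifN //; lia.
- move=> v hv; rewrite [nmem s5 19 v]/=; move: hv.
  case: (eqVneq v u) => [->|vu] hv /=.
    by rewrite jE /top_after (negbTE hv).
  rewrite (sd_top D4) ?X7' ?F2 // X19' //.
  by rewrite /top_after (negbTE hv).
- by apply: preserved_best P45 _ _ (sd_best D4).
- move=> z hz; apply: preserved_covered P45 _ _ (sd_best D4) _ => //.
  apply: (sd_mono D4); apply: (sd_mono D3).
  by apply: preserved_covered P2 _ _ hb hz; rewrite (exp_nmem X).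
- move=> z hz /=; case: ifPn => [zu|zu] zy.
    apply: preserved_covered P45 _ _ (sd_best D4) _ => //.
    apply: (sd_mono D4); apply: (sd_cover D3) => //=; exact/andP.
  apply: preserved_covered P45 _ _ (sd_best D4) _ => //.
  by apply: (sd_cover D4) => //=; rewrite ltNge zu.
Qed.

End Search.

(** * Reading off the perturbation *)

Section Output.
Variables (R : realType) (d : nat) (x : 'rV[R]_d).
Implicit Types (s : store R) (p : seq (answer R d)).

Lemma output_bodyP s (s' := run output_body s) (f := frame_of s (nmem s 7 0%N))
    (t := f_feat f) (fresh := nmem s 20 t == 0%N)
    (v := f_hi f - rmem s 0 t) (r := rmem s 2 0%N) :
  [/\ nmem s' 7 0 = f_par f /\ nmem s' 6 0 = nmem s 6 0,
      forall k, frame_of s' k = frame_of s k,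
      forall a k, (a < 3)%N -> rmem s' a k = rmem s a k,
      forall u, nmem s' 20 u = (if (u == t) && fresh then 1%N else nmem s 20 u)
    & forall u, rmem s' 3 u = (if (u == t) && fresh then
         if (f_hf f == 1%N) && (v <= r) then v else r else rmem s 3 u)].
Proof.
rewrite {}/s' /output_body run_seq run_seq; set s1 := run (nset 22 _) s.
rewrite run_if; have -> : beval s1 (BNEq (NRead 20 (nvar 22)) (NConst 0)) = fresh by [].
case: fresh.
  rewrite /write_delta run_seq run_nset run_seq run_rset run_if.
  set b := beval _ _.
  have -> : b = (f_hf f == 1%N) && (v <= r) by [].
  case: (_ && _); rewrite ?run_rset run_nset; split=> //.
  - by move=> a k; rewrite [rmem _]/=; case: a => [|[|[|]]].
  - by move=> u; rewrite andbT.
  - by move=> u /=; rewrite andbT; case: eqP.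
  - by move=> a k; rewrite [rmem _]/=; case: a => [|[|[|]]].
  - by move=> u; rewrite andbT.
  - by move=> u /=; rewrite andbT; case: eqP.
by rewrite run_nset; split=> // u; rewrite andbF.
Qed.

Lemma frame_of_represents s s' i p :
  (forall k, frame_of s' k = frame_of s k) ->
  represents x s i p -> represents x s' i p.
Proof.
move=> fE; elim: p i => [|[[u eta] b] p IH] i; first by rewrite /represents fE.
by rewrite !represents_cons !fE => -[h1 [h2 h3 h4 h5 /IH h6]].
Qed.

(** A fresh feature gets its final value from the deepest frame testing it, whose upper bound is
    that of the whole path; for other features, dropping the deepest test changes neither [upper]
    nor [tested]. *)
Lemma output_path p s :
  represents x s (nmem s 7 0) p -> (forall t : 'I_d, rmem s 0 t = x ord0 t) ->
  exists s', [/\ iterates output_guard output_body (size p) s s',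
    ~~ beval s' output_guard, nmem s' 6 0 = nmem s 6 0,
    rmem s' 2 0 = rmem s 2 0
  & forall t : 'I_d, rmem s' 3 t =
      if (nmem s 20 t == 0%N) && tested p t then coord_shift x p (rmem s 2 0) t
      else rmem s 3 t].
Proof.
elim: p s => [|[[u eta] b] p IH] s.
  move=> [_ e] hx; exists s; split=> //=; first exact: iterates0.
  - by rewrite e.
  - by move=> t; rewrite andbF.
rewrite represents_cons => -[_ [h1 h2 h3 h4 h5]] hx.
have [] := output_bodyP s; lazy zeta; set s1 := run output_body s.
rewrite h3 hx => -[e7 e6] fE hr h20 hd.
have hp1 : represents x s1 (nmem s1 7 0%N) p.
  by rewrite e7; exact: frame_of_represents h5.
have hx1 (t : 'I_d) : rmem s1 0 t = x ord0 t by rewrite hr.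
have [s' [it ng h6 hr2 hd2]] := IH s1 hp1 hx1.
exists s'; split=> //.
- by apply: iteratesS it => /=; lia.
- by rewrite h6.
- by rewrite hr2 hr.
move=> t; rewrite hd2 hr // h20 hd /coord_shift /upper /tested /=.
have [->|tu] := eqVneq t u.
  rewrite !eqxx /=; case: (nmem s 20 u =P 0%N) => [e|/eqP/negbTE ->] //=.
  have := h4 false; rewrite /fbound /= eqxx /=.
  by case: ifP => _ /= <-.
have tu' : (t == u :> nat) = false by apply/eqP => /val_inj e; rewrite e eqxx in tu.
by rewrite tu'.
Qed.

End Output.

(** * Correctness and running time of the whole program *)

Section Correctness.
Variables (R : realType) (d C : nat) (T : dtree R d C).
Variables (x : 'rV[R]_d) (y0 : 'I_C).

Lemma searching_prologue (s : store R) : input_store T x y0 s ->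
  searching T x y0 (run prologue s) T [::].
Proof.
move=> [hT hx hy hn hr].
have P : preserved s (run prologue s).
  split.
  - by rewrite hn.
  - move=> k; rewrite hn // leqn0 => /eqP ->; rewrite /frame_of /=.
    by [].
  - by move=> a k ha; rewrite [nmem _]/= !upd_out //; lia.
  - by [].
split=> //.
- have -> : nmem (run prologue s) 18 (nmem (run prologue s) 7 0%N) = 0%N by exact: hn.
  exact: preserved_stored P hT.
- by rewrite /represents /fkey /frame_of /= !hn // hr.
(* Array 19 is still zero, so every feature points to frame 0, whose cleared flags encode the
   absence of bounds. *)
- move=> t; have -> : top_after (run prologue s) t = 0%N.
    by rewrite /top_after /= !hn //; case: ifP.
  have F0 : f_lf (frame_of s 0) = 0%N /\ f_hf (frame_of s 0) = 0%N.
    by rewrite /= !hn.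
  have F1 : frame_of (run prologue s) 0 = frame_of s 0 by [].
  by rewrite F1 /fbound F0.1 F0.2; split=> // -[].
- by left; rewrite /= !hn.
Qed.

(** With n nodes, the search evaluates its guard at most 2n + 1 times and the output loop at most n
    + 1 times; since n is positive these are at most 3n and 2n. *)
Lemma attack_correct (s : store R) : input_store T x y0 s ->
  exists (s' : store R) (k : nat), [/\ exec attack s s' k,
    (k <= (max_cost prologue + 3 * (bcost search_guard + max_cost search_body).+1
      + max_cost epilogue
      + 2 * (bcost output_guard + max_cost output_body).+1) * num_nodes T)%N
  & correct_output T x y0 s'].
Proof.
move=> hin; have [hT hx hy hn hr] := hin.
have n0 : (0 < num_nodes T)%N by case: T.
have [k0 e0 hk0] := run_exec s (erefl : loop_free prologue).
have S0 := searching_prologue hin.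
have [m [s1 [hm it1 D1]]] := search_tree S0.
have guard1 : ~~ beval s1 search_guard.
  by rewrite /= (sd_cur D1) /= hn.
have [k1 e1 hk1] := while_exec (erefl : loop_free search_body) it1 guard1.
have [k2 e2 hk2] := run_exec s1 (erefl : loop_free epilogue).
set s2 := run epilogue s1 in e2.
have d0 (j : 'I_d) : rmem s2 3 j = 0.
  by rewrite /s2 /= (pres_rmem (sd_pres D1)) //= hr.
have t0 (j : 'I_d) : nmem s2 20 j = 0%N.
  by rewrite /s2 /= (pres_nmem (sd_pres D1)) //= hn.
have x2 (j : 'I_d) : rmem s2 0 j = x ord0 j.
  by rewrite /s2 /= (pres_rmem (sd_pres D1)) //= hx.
suff [s3 [m3 [hm3 it3 guard3 cor]]] : exists s3 m3,
    [/\ (m3 <= num_nodes T)%N, iterates output_guard output_body m3 s2 s3,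
        ~~ beval s3 output_guard & correct_output T x y0 s3].
  have [k3 e3 hk3] := while_exec (erefl : loop_free output_body) it3 guard3.
  exists s3, (k0 + (k1 + (k2 + k3)))%N; split=> //.
    exact: ESeq e0 (ESeq e1 (ESeq e2 e3)).
  move: hk0 hk1 hk2 hk3.
  move: (max_cost prologue) (_ + max_cost search_body).+1%N.
  move: (max_cost epilogue) (_ + max_cost output_body).+1%N => D E A B.
  move=> hk0 hk1 hk2 hk3.
  rewrite !mulnDl; apply: leq_trans (_ : A + (B * m.+1 + (D + E * m3.+1)) <= _)%N.
    by rewrite !leq_add.
  have : (B * m.+1 <= B * (3 * num_nodes T))%N by rewrite leq_mul2l; lia.
  have : (E * m3.+1 <= E * (2 * num_nodes T))%N by rewrite leq_mul2l; lia.
  have : (A * 1 <= A * num_nodes T)%N by rewrite leq_mul2l n0 orbT.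
  have : (D * 1 <= D * num_nodes T)%N by rewrite leq_mul2l n0 orbT.
  lia.
have cover z : classify T z <> y0 -> covered x s1 z.
  by move=> hz; apply: (sd_cover D1).
case: (sd_best D1) => [[e6 e9]|[e6 [p [_ hp tp hadv hsz]]]].
  (* With no leaf recorded, [cover] shows that no perturbation is adversarial, so [rstar] is
     infinite and the output loop makes no pass. *)
  exists s2, 0%N; split=> //.
  - exact: iterates0.
  - by rewrite /s2 /= e9.
  have none v : ~ adversarial T x y0 v by move=> /cover[]; rewrite e6.
  split.
  - rewrite /output_r [nmem s2 6 0%N]/= e6 /=; apply/esym/ereal_inf_pinfty.
    by move=> y [v adv_v]; case: (none v adv_v).
  - by move=> [v [adv_v]]; case: (none v adv_v).
  - by move=> [v adv_v]; case: (none v adv_v).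
have hp2 : represents x s2 (nmem s2 7 0%N) p.
  by apply: frame_of_represents hp => k.
have [s3 [it3 guard3 h6 h2 hd]] := output_path hp2 x2.
exists s3, (size p); split=> //.
have keyE := represents_dist hp.
have rE : rmem s2 2 0 = (dist x p).1 by rewrite -keyE.
have closest z : classify T z <> y0 -> admits (dist x p) `|z - x|.
  by move=> /cover[_]; rewrite keyE.
(* Untested coordinates are 0 because array 3 of reals was zero initially and the search does not
   write to it. *)
have dE : output_delta d s3 = perturb x p (dist x p).1.
  by apply/rowP => j; rewrite !mxE hd t0 d0 -rE.
split.
- rewrite /output_r h6 [nmem s2 6 0%N]/= e6 /= h2 rE.
  by rewrite (rstarE tp hadv closest).
- by rewrite dE; exact: min_adversarial_perturb.
- move=> _; rewrite dE (rstarE tp hadv closest) (norm_delta tp hadv closest).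
  by split=> //; exact: closure_perturb.
Qed.

End Correctness.

Theorem mainTheorem2 :
  exists (P : cmd) (K : nat),
    forall (R : realType) (d C : nat) (T : dtree R d C)
      (x : 'rV[R]_d) (y0 : 'I_C) (s : store R),
      y0 = classify T x ->
      input_store T x y0 s ->
      exists (s' : store R) (k : nat),
        [/\ exec P s s' k,
            (k <= K * num_nodes T)%N
          & correct_output T x y0 s'].
Proof.
(* [K] is read off from the bound of [attack_correct], which depends only on the program text. *)
by exists attack; eexists => R d C T x y0 s _; exact: attack_correct.
Qed.
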